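(* Let $\delta\in\mathbb{C}$. The birational transformations $$X=x,\qquad Y=y+\frac{3(1-\sqrt5)}{2}x^2,\qquad Z=z+3(1-\sqrt5)xy+9(3-\sqrt5)x^3,\qquad S=\frac{8}{3(1-\sqrt5)}\,s$$ take the partial differential system in $(t,s)$ $$\begin{aligned} dx=&\left\{-\tfrac32(\sqrt5-1)x^2+y\right\}dt+\left\{-12(\sqrt5+2)x^2y+(\sqrt5+1)\left(3xz-2y^2-\tfrac23\delta\right)\right\}ds,\\ dy=&\;z\,dt+\left\{-6(2\sqrt5-5)x^2z+12\sqrt5\,xy^2-(\sqrt5+1)yz+(3\sqrt5-5)\delta x\right\}ds,\\ dz=&\left\{3(\sqrt5+3)y^2+3(\sqrt5-1)xz+\delta\right\}dt+\left\{48xyz-24y^3-(\sqrt5+1)z^2+2(\sqrt5-3)\delta y\right\}ds \end{aligned}$$ to the system in $(t,S)$ $$\begin{aligned} dX=&\;Y\,dt+\left(54X^4+18X^2Y+3Y^2-\tfrac92XZ+\delta\right)dS,\\ dY=&\;Z\,dt+\left(-243X^5-108X^3Y-18XY^2+18X^2Z+\tfrac32YZ-\tfrac92\delta X\right)dS,\\ dZ=&\left(54X^4+72X^2Y+12Y^2+\delta\right)dt+\left(972X^6+162X^4Y-108X^3Z+\tfrac32Z^2+18\delta X^2-3\delta Y\right)dS . \end{aligned}$$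
   Context: $x,y,z$ are unknown complex functions of $(t,s)$ and $X,Y,Z$ of $(t,S)$; the coefficients of $dt$ and $ds$ (resp. $dS$) prescribe the partial derivatives of the unknowns with respect to $t$ and $s$ (resp. $S$). ''Take'' means that $(x,y,z)$ satisfies the first system if and only if $(X,Y,Z)$, as functions of $(t,S)$, satisfies the second. *)

(* Defs.v *)
From mathcomp Require Import all_boot all_order all_algebra.
From mathcomp Require Import complex.
From mathcomp Require Import boolp classical_sets reals topology normedtype derive.
(* The notations of mpoly conflict with those of analysis. *)
From mathcomp Require mpoly.
Import (canonicals, coercions) mpoly.

Set Implicit Arguments.
Unset Strict Implicit.
Unset Printing Implicit Defensive.

Import Order.TTheory GRing.Theory Num.Theory.
Import numFieldNormedType.Exports.
Local Open Scope classical_set_scope.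
Local Open Scope ring_scope.
Local Open Scope complex_scope.

(* Packing R[i] as a numFieldType gives it the topology and the derivatives
   (here complex ones) that analysis attaches to every numFieldType. *)
Definition CC (R : realType) : numFieldType := R[i].

Definition sqrt5 (R : realType) : CC R := (Num.sqrt (5 : R))%:C.

Section Birational.
Variables (K : fieldType) (n : nat).
Implicit Types (F G : ('I_n -> K) -> 'I_n -> K) (q : mpoly.mpoly n K).

(* q is a common denominator; the values of F on the zero set of q are junk. *)
Definition rational_map F q : Prop :=
  q != 0 /\
  forall j, exists p : mpoly.mpoly n K, forall v : 'I_n -> K,
    mpoly.meval v q != 0 -> F v j = mpoly.meval v p / mpoly.meval v q.

(* The points where neither denominator vanishes form a nonempty Zariski-open
   set, on which the composite G \o F is the identity. *)
Definition left_inverse_map F qF G qG : Prop :=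
  (exists v, mpoly.meval v qF != 0 /\ mpoly.meval (F v) qG != 0) /\
  (forall v, mpoly.meval v qF != 0 -> mpoly.meval (F v) qG != 0 ->
     G (F v) =1 v).

Definition birational F : Prop :=
  exists qF G qG,
    [/\ rational_map F qF, rational_map G qG,
        left_inverse_map F qF G qG & left_inverse_map G qG F qF].

End Birational.

Section Systems.
Variable R : realType.
Local Notation C := (CC R).
Local Notation r5 := (sqrt5 R).
Implicit Types (f x y z X Y Z : C -> C -> C) (U : set (C * C)).

Definition point4 (a b c d : C) : 'I_4 -> C := fun i => [:: a; b; c; d]`_i.

Definition Sscale : C := 8 / (3 * (1 - r5)).

(* (x, y, z, s) |-> (X, Y, Z, S) *)
Definition change (p : 'I_4 -> C) : 'I_4 -> C :=
  let x := p 0 in let y := p 1 in let z := p 2 in let s := p 3 in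
  point4
    x
    (y + 3 * (1 - r5) / 2 * x ^+ 2)
    (z + 3 * (1 - r5) * x * y + 9 * (3 - r5) * x ^+ 3)
    (Sscale * s).

(* (X, Y, Z), as functions of (t, S), are the transforms of (x, y, z) over U. *)
Definition transforms U x y z X Y Z : Prop :=
  forall t s, U (t, s) ->
    let q := change (point4 (x t s) (y t s) (z t s) s) in
    [/\ X t (q 3) = q 0, Y t (q 3) = q 1 & Z t (q 3) = q 2].

Definition domainS U : set (C * C) := [set (p.1, Sscale * p.2) | p in U].

(* The reading of df = a dt + b ds at (t, s). *)
Definition has_partials f (t s a b : C) : Prop :=
  is_derive t (1 : C) (f^~ s) a /\ is_derive s (1 : C) (f t) b.

Definition solves_xyz (delta : C) U x y z : Prop :=
  forall t s, U (t, s) ->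
  let x0 := x t s in let y0 := y t s in let z0 := z t s in
  [/\ has_partials x t s
        (- (3 / 2) * (r5 - 1) * x0 ^+ 2 + y0)
        (- 12 * (r5 + 2) * x0 ^+ 2 * y0
         + (r5 + 1) * (3 * x0 * z0 - 2 * y0 ^+ 2 - 2 / 3 * delta)),
      has_partials y t s
        z0
        (- 6 * (2 * r5 - 5) * x0 ^+ 2 * z0 + 12 * r5 * x0 * y0 ^+ 2
         - (r5 + 1) * y0 * z0 + (3 * r5 - 5) * delta * x0)
    & has_partials z t s
        (3 * (r5 + 3) * y0 ^+ 2 + 3 * (r5 - 1) * x0 * z0 + delta)
        (48 * x0 * y0 * z0 - 24 * y0 ^+ 3 - (r5 + 1) * z0 ^+ 2
         + 2 * (r5 - 3) * delta * y0)].

Definition solves_XYZ (delta : C) V X Y Z : Prop :=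
  forall t S, V (t, S) ->
  let X0 := X t S in let Y0 := Y t S in let Z0 := Z t S in
  [/\ has_partials X t S
        Y0
        (54 * X0 ^+ 4 + 18 * X0 ^+ 2 * Y0 + 3 * Y0 ^+ 2 - 9 / 2 * X0 * Z0
         + delta),
      has_partials Y t S
        Z0
        (- 243 * X0 ^+ 5 - 108 * X0 ^+ 3 * Y0 - 18 * X0 * Y0 ^+ 2
         + 18 * X0 ^+ 2 * Z0 + 3 / 2 * Y0 * Z0 - 9 / 2 * delta * X0)
    & has_partials Z t S
        (54 * X0 ^+ 4 + 72 * X0 ^+ 2 * Y0 + 12 * Y0 ^+ 2 + delta)
        (972 * X0 ^+ 6 + 162 * X0 ^+ 4 * Y0 - 108 * X0 ^+ 3 * Z0
         + 3 / 2 * Z0 ^+ 2 + 18 * delta * X0 ^+ 2 - 3 * delta * Y0)].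

End Systems.

(* Main.v *)
Require Import Defs.
From mathcomp Require Import all_boot all_order all_algebra.
From mathcomp Require Import complex ring.
From mathcomp Require Import boolp classical_sets reals topology normedtype derive.
From mathcomp Require mpoly.
Import (canonicals, coercions) mpoly.
Import numFieldNormedType.Exports.
Import GRing.Theory Num.Theory.
Set Implicit Arguments.
Unset Strict Implicit.
Unset Printing Implicit Defensive.
Local Open Scope classical_set_scope.
Local Open Scope ring_scope.

(** The change of variables is triangular: with suitable constants it reads
      X = x,  Y = y + al x^2,  Z = z + be x y + ga x^3,  S = c s,  c != 0.
    Its inverse is again of this form, with constants
      c^-1,  - al,  - be,  al be - ga
    (triangularK), so the map is polynomial with polynomial inverse, hence
    birational with both denominators equal to 1.

    For the systems, the product rule and the rescaling of the second variable
    express the partial derivatives of X, Y, Z at (t, c s) through those of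
    x, y, z at (t, s) (partials_transforms).  Openness of the domain is what
    allows differentiating the relations between the unknowns, which are only
    given on that domain.  If (x, y, z) solves the first system, these
    derivatives are explicit polynomials in x, y, z, and they agree with the
    right-hand sides of the second system by a polynomial identity modulo
    r^2 = 5, where r is the square root of 5.  The converse is the same
    argument for the inverse change of variables, which is legitimate because
    the image of the domain is again open; thanks to the shape of the inverse,
    one lemma serves both directions. *)

(** * Polynomial maps with polynomial inverse are birational *)

Section PolynomialMaps.
Variables (K : fieldType) (n : nat).

Definition polynomial_function (f : ('I_n -> K) -> K) : Prop :=
  exists p : mpoly.mpoly n K, forall v, mpoly.meval v p = f v.

Lemma polyfun_cst c : polynomial_function (fun=> c).
Proof. by exists (mpoly.mpolyC n c) => v; rewrite mpoly.mevalC. Qed.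

Lemma polyfun_coord i : polynomial_function (fun v => v i).
Proof. by exists (mpoly.mpolyX K (mpoly.mnm1 i)) => v; rewrite mpoly.mevalXU. Qed.

Lemma polyfunD f g : polynomial_function f -> polynomial_function g ->
  polynomial_function (fun v => f v + g v).
Proof.
by move=> [p pE] [q qE]; exists (p + q) => v; rewrite mpoly.mevalD pE qE.
Qed.

Lemma polyfunM f g : polynomial_function f -> polynomial_function g ->
  polynomial_function (fun v => f v * g v).
Proof.
by move=> [p pE] [q qE]; exists (p * q) => v; rewrite mpoly.mevalM pE qE.
Qed.

Lemma polyfunX f k : polynomial_function f ->
  polynomial_function (fun v => f v ^+ k).
Proof.
move=> pf; elim: k => [|k IHk]; first exact: polyfun_cst.
have [p pE] := polyfunM pf IHk.
by exists p => v; rewrite pE exprS.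
Qed.

Lemma polynomial_rational_map (F : ('I_n -> K) -> 'I_n -> K) :
  (forall j, polynomial_function (F^~ j)) -> rational_map F 1.
Proof.
move=> pF; split; first exact: oner_neq0.
move=> j; have [p pE] := pF j.
by exists p => v _; rewrite mpoly.meval1 divr1 pE.
Qed.

Lemma polynomial_birational (F G : ('I_n -> K) -> 'I_n -> K) :
  (forall j, polynomial_function (F^~ j)) ->
  (forall j, polynomial_function (G^~ j)) ->
  (forall v, G (F v) =1 v) -> (forall v, F (G v) =1 v) -> birational F.
Proof.
move=> pF pG FK GK; exists 1, G, 1.
by split; (try exact: polynomial_rational_map); split;
  (try by exists (fun=> 0); rewrite !mpoly.meval1 oner_neq0); move=> v _ _ //.
Qed.

End PolynomialMaps.

(** * Derivative of a composite *)

Section ChainRule.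
Variable K : numFieldType.

(** Holds over every numeric field, in particular for complex derivatives,
    because a function of one variable is derivable exactly when it is
    differentiable. *)
Lemma is_derive1_chain (f g : K -> K) (x df dg : K) :
  is_derive x 1 f df -> is_derive (f x) 1 g dg ->
  is_derive x 1 (g \o f) (df * dg).
Proof.
move=> [/derivable1_diffP fx <-] [/derivable1_diffP gx <-].
have gfx : differentiable (g \o f) x by exact: differentiable_comp.
apply: DeriveDef; first exact/derivable1_diffP.
by rewrite !deriveE // diff_comp //= -[X in 'd _ _ X]mulr1 [LHS]linearZ.
Qed.

End ChainRule.

(** * Triangular changes of variables *)

Section Triangular.
Variable R : realType.
Local Notation C := (CC R).

Definition triangular (c al be ga : C) (p : 'I_4 -> C) : 'I_4 -> C :=
  point4 (p 0) (p 1 + al * p 0 ^+ 2)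
    (p 2 + be * p 0 * p 1 + ga * p 0 ^+ 3) (c * p 3).

(** The terms in x^3 cancel: replacing y by y + al x^2 in - be x y creates
    - al be x^3, and al be - ga absorbs both this term and ga x^3. *)
Lemma triangularK c al be ga p : c != 0 ->
  triangular c^-1 (- al) (- be) (al * be - ga) (triangular c al be ga p) =1 p.
Proof.
move=> c0; case; case=> [|[|[|[|//]]]] i4;
  rewrite /triangular /point4 /=; set i := Ordinal i4.
(* The numerals 0, 1, 2, 3 of 'I_4 are equal to i only by value. *)
- by congr p; apply: val_inj.
- by rewrite [p i](_ : _ = p 1); [ring|congr p; apply: val_inj].
- by rewrite [p i](_ : _ = p 2); [ring|congr p; apply: val_inj].
- by rewrite mulKf //; congr p; apply: val_inj.
Qed.

(** The involution (c, al, be, ga) |-> (c^-1, - al, - be, al be - ga) turns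
    triangularK into the other cancellation law. *)
Lemma triangularVK c al be ga p : c != 0 ->
  triangular c al be ga (triangular c^-1 (- al) (- be) (al * be - ga) p) =1 p.
Proof.
move=> c0.
have := @triangularK c^-1 (- al) (- be) (al * be - ga) p.
by rewrite invr_eq0 invrK !opprK mulrNN subKr; apply.
Qed.

Lemma triangular_polynomial c al be ga j :
  polynomial_function (fun p => triangular c al be ga p j).
Proof.
case: j; case=> [|[|[|[|//]]]] i4; rewrite /triangular /point4 /=;
  by repeat first [exact: polyfun_coord | exact: polyfun_cst
    | apply: polyfunD | apply: polyfunM | apply: polyfunX].
Qed.

Lemma triangular_birational c al be ga : c != 0 ->
  birational (triangular c al be ga).
Proof.
move=> c0.
apply: (@polynomial_birational _ _ _
  (triangular c^-1 (- al) (- be) (al * be - ga))).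
- exact: triangular_polynomial.
- exact: triangular_polynomial.
- by move=> v; apply: triangularK.
- by move=> v; apply: triangularVK.
Qed.

(** * Partial derivatives of the transformed functions *)

Implicit Types (f x y z X Y Z : C -> C -> C) (U : set (C * C)).

Lemma near_slicel U t s : open U -> U (t, s) -> \forall t' \near t, U (t', s).
Proof.
move=> oU Uts; have : nbhs (t, s) U by exact: open_nbhs_nbhs.
exact: (cvg_pair (@cvg_id _ (nbhs t)) (@cvg_cst _ s _ (nbhs t) _)).
Qed.

Lemma near_slicer U t s : open U -> U (t, s) -> \forall s' \near s, U (t, s').
Proof.
move=> oU Uts; have : nbhs (t, s) U by exact: open_nbhs_nbhs.
exact: (cvg_pair (@cvg_cst _ t _ (nbhs s) _) (@cvg_id _ (nbhs s))).
Qed.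

Definition scaled_domain (c : C) U : set (C * C) :=
  [set (p.1, c * p.2) | p in U].

Lemma scaled_domainE (c : C) U : c != 0 ->
  scaled_domain c U = (fun p => (p.1, c^-1 * p.2)) @^-1` U.
Proof.
move=> c0; apply/seteqP; split=> [_ [[t s] Uts <-]|[t s] Uts] /=.
  by rewrite mulKf.
by exists (t, c^-1 * s) => //=; rewrite mulVKf.
Qed.

Lemma scaled_domain_open (c : C) U :
  c != 0 -> open U -> open (scaled_domain c U).
Proof.
move=> c0 oU; rewrite scaled_domainE //; apply: open_comp => // -[t s] _.
apply: (@cvg_pair _ _ _ (nbhs (t, s)) (nbhs t) (nbhs (c^-1 * s)) _ _ _
  (fun q : C * C => q.1) (fun q : C * C => c^-1 * q.2)).
  exact: cvg_fst.
by apply: cvgM; [exact: cvg_cst|exact: cvg_snd].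
Qed.

(** The equality between F and G holds on U only; since U is open, it holds near
    the point along both coordinate lines, which is all that partial
    derivatives see. *)
Lemma has_partials_scale F G (c : C) U (t s g1 g2 : C) :
  c != 0 -> open U -> U (t, s) ->
  (forall t' s', U (t', s') -> F t' (c * s') = G t' s') ->
  has_partials G t s g1 g2 -> has_partials F t (c * s) g1 (c^-1 * g2).
Proof.
move=> c0 oU Uts FG [G1 G2]; split.
  apply: near_eq_is_derive G1; near=> t'; rewrite FG//.
  by near: t'; exact: near_slicel.
have oV := scaled_domain_open c0 oU.
have Vts : scaled_domain c U (t, c * s) by exists (t, s).
apply: (@near_eq_is_derive _ _ _ (G t \o ( *%R c^-1))).
  near=> S; have : scaled_domain c U (t, S) by near: S; exact: near_slicer.
  by rewrite scaled_domainE //= => /FG <-; rewrite mulVKf.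
apply: is_derive1_chain; last by rewrite mulKf.
rewrite -[X in is_derive _ _ _ X](mulr1 c^-1).
exact: (is_deriveZ c^-1 (is_derive_id (c * s) 1)).
Unshelve. all: by end_near. Qed.

Lemma has_partials_eq f (t s f1 f2 g1 g2 : C) :
  has_partials f t s f1 f2 -> f1 = g1 -> f2 = g2 -> has_partials f t s g1 g2.
Proof. by move=> h <- <-. Qed.

Lemma has_partialsD (f g : C -> C -> C) (t s f1 f2 g1 g2 : C) :
  has_partials f t s f1 f2 -> has_partials g t s g1 g2 ->
  has_partials (fun t s => f t s + g t s) t s (f1 + g1) (f2 + g2).
Proof. by move=> [? ?] [? ?]; split; apply: is_deriveD. Qed.

Lemma has_partialsM (f g : C -> C -> C) (t s f1 f2 g1 g2 : C) :
  has_partials f t s f1 f2 -> has_partials g t s g1 g2 ->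
  has_partials (fun t s => f t s * g t s) t s
    (f t s * g1 + g t s * f1) (f t s * g2 + g t s * f2).
Proof. by move=> [? ?] [? ?]; split; apply: is_deriveM. Qed.

Lemma has_partials_cst (k : C) t s : has_partials (fun _ _ => k) t s 0 0.
Proof. by split; apply: is_derive_cst. Qed.

(** The constants are arbitrary so that the inverse change of variables is
    covered too. *)
Definition transforms_by c al be ga U x y z X Y Z : Prop :=
  forall t s, U (t, s) ->
  let q := triangular c al be ga (point4 (x t s) (y t s) (z t s) s) in
  [/\ X t (q 3) = q 0, Y t (q 3) = q 1 & Z t (q 3) = q 2].

Lemma transforms_by_inv (c al be ga : C) U x y z X Y Z : c != 0 ->
  transforms_by c al be ga U x y z X Y Z ->
  transforms_by c^-1 (- al) (- be) (al * be - ga) (scaled_domain c U)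
    X Y Z x y z.
Proof.
move=> c0 tr _ _ [[t s] Uts [<- <-]].
have [XE YE ZE] := tr t s Uts.
have := triangularK al be ga (point4 (x t s) (y t s) (z t s) s) c0.
move: XE YE ZE; rewrite /triangular /point4 /= => -> -> -> E.
by rewrite mulKf//; split; rewrite -?[LHS](E 0) -?[LHS](E 1) -?[LHS](E 2).
Qed.

(** dY and dZ are the differentials of y + al x^2 and z + be x y + ga x^3,
    applied to the derivatives of x, y, z in either variable; the factor c^-1
    comes from s = c^-1 S. *)
Lemma partials_transforms (c al be ga : C) U x y z X Y Z
    (t s x1 x2 y1 y2 z1 z2 : C) :
  c != 0 -> open U -> U (t, s) -> transforms_by c al be ga U x y z X Y Z ->
  has_partials x t s x1 x2 -> has_partials y t s y1 y2 ->
  has_partials z t s z1 z2 ->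
  let dY dx dy := dy + 2 * al * x t s * dx in
  let dZ dx dy dz :=
    dz + be * (y t s * dx + x t s * dy) + 3 * ga * x t s ^+ 2 * dx in
  [/\ has_partials X t (c * s) x1 (c^-1 * x2),
      has_partials Y t (c * s) (dY x1 y1) (c^-1 * dY x2 y2)
    & has_partials Z t (c * s) (dZ x1 y1 z1) (c^-1 * dZ x2 y2 z2)].
Proof.
move=> c0 oU Uts tr hx hy hz dY dZ.
have hM (k : C) (f g : C -> C -> C) (f1 f2 g1 g2 : C) :
    has_partials f t s f1 f2 -> has_partials g t s g1 g2 ->
    has_partials (fun t s => k * f t s * g t s) t s
      (k * (f t s * g1 + g t s * f1)) (k * (f t s * g2 + g t s * f2)).
  move=> hf hg.
  apply: has_partials_eq (has_partialsM
    (has_partialsM (has_partials_cst k t s) hf) hg) _ _ => /=; ring.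
(* The factor 1 lets hM, applied twice, produce the cube ga * x * (1 * x * x). *)
have hxx := hM 1 _ _ _ _ _ _ hx hx.
split.
- apply: (has_partials_scale c0 oU Uts _ hx) => t' s' /tr[] //.
- apply: (has_partials_scale (G := fun t s => y t s + al * x t s * x t s)
    c0 oU Uts).
    by move=> t' s' /tr[_ YE _]; rewrite [LHS]YE /triangular /point4 /=; ring.
  apply: has_partials_eq (has_partialsD hy (hM al _ _ _ _ _ _ hx hx)) _ _;
    rewrite /dY; ring.
- apply: (has_partials_scale (G := fun t s => z t s + be * x t s * y t s
    + ga * x t s * (1 * x t s * x t s)) c0 oU Uts).
    by move=> t' s' /tr[_ _ ZE]; rewrite [LHS]ZE /triangular /point4 /=; ring.
  apply: has_partials_eq (has_partialsD (has_partialsD hz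
    (hM be _ _ _ _ _ _ hx hy)) (hM ga _ _ _ _ _ _ hx hxx)) _ _;
    rewrite /dZ; ring.
Qed.

(** * The constants of the transformation *)

Local Notation r5 := (sqrt5 R).

Lemma sqr_sqrt5 : r5 ^+ 2 = 5.
Proof.
rewrite /sqrt5 -[LHS]rmorphXn /= sqr_sqrtr ?ler0n//.
exact: (rmorph_nat (real_complex R) 5).
Qed.

Lemma SscaleVE : (Sscale R)^-1 = 3 / 8 * (1 - r5).
Proof. by rewrite /Sscale invf_div; field. Qed.

(** A form of (1 - r5) (1 + r5) = -4: it shows that 1 - r5 is invertible and
    rationalizes the denominator of Sscale. *)
Lemma mulr_Sscale : 3 / 8 * (1 - r5) * - (2 / 3 * (1 + r5)) = 1.
Proof. by field: sqr_sqrt5. Qed.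

Lemma Sscale_neq0 : Sscale R != 0.
Proof.
rewrite -invr_eq0 SscaleVE; apply/eqP => c0.
by have /eqP := mulr_Sscale; rewrite c0 mul0r eq_sym oner_eq0.
Qed.

Lemma SscaleE : Sscale R = - (2 / 3 * (1 + r5)).
Proof.
apply: (mulfI (invr_neq0 Sscale_neq0)).
by rewrite mulVf ?Sscale_neq0 // SscaleVE mulr_Sscale.
Qed.

End Triangular.

(** * Equivalence of the two systems *)

Theorem theorem11p1 (R : realType) (delta : CC R) :
  birational (@change R) /\
  forall (U : set (CC R * CC R)) (x y z X Y Z : CC R -> CC R -> CC R),
    open U -> transforms U x y z X Y Z ->
    (solves_xyz delta U x y z <-> solves_XYZ delta (domainS U) X Y Z).
Proof.
have c0 := Sscale_neq0 R; have r2 := sqr_sqrt5 R.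
split; first exact: (triangular_birational _ _ _ c0).
move=> U x y z X Y Z oU tr.
split=> [sol _ _ [[t s] Uts [<- <-]]|sol t s Uts] /=.
  have [XE YE ZE] := tr t s Uts.
  have [hx hy hz] := sol t s Uts.
  have [] := partials_transforms c0 oU Uts tr hx hy hz.
  move: XE YE ZE; rewrite /change /point4 /= => -> -> ->.
  rewrite SscaleVE.
  (* What remains are polynomial identities in r, x0, y0, z0 modulo r^2 = 5. *)
  move: (sqrt5 R) r2 (x t s) (y t s) (z t s) => r r2 x0 y0 z0 hX hY hZ.
  split.
  - by apply: has_partials_eq hX _ _; field: r2.
  - by apply: has_partials_eq hY _ _; field: r2.
  - by apply: has_partials_eq hZ _ _; field: r2.
(* The converse uses the inverse change on the open image of U. *)
have oV := scaled_domain_open c0 oU.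
have trV := transforms_by_inv c0 tr.
have Vts : scaled_domain (Sscale R) U (t, Sscale R * s) by exists (t, s).
have cV0 : (Sscale R)^-1 != 0 by rewrite invr_eq0.
have [XE YE ZE] := tr t s Uts.
have [hX hY hZ] := sol _ _ Vts.
have [] := partials_transforms cV0 oV Vts trV hX hY hZ.
move: XE YE ZE; rewrite /change /point4 /= => -> -> ->.
rewrite mulKf // invrK SscaleE.
move: (sqrt5 R) r2 (x t s) (y t s) (z t s) => r r2 x0 y0 z0 hx hy hz.
split.
- by apply: has_partials_eq hx _ _; field: r2.
- by apply: has_partials_eq hy _ _; field: r2.
- by apply: has_partials_eq hz _ _; field: r2.
Qed.
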